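(* Let $X$ be a one-dimensional shift of finite type, $\mu$ a $\sigma$-invariant Borel probability measure on $X$, and $(X,\phi)$ a $\mu$-equicontinuous cellular automaton. Let $\mu_\infty$ be the weak limit of $\frac1n\sum_{i=1}^n\phi^i\mu$ as $n\to\infty$. Then $(X,\phi,\mu_\infty)$ is isomorphic (measurably) to a cyclic permutation on a finite set if and only if $\mu_\infty$ is $\phi$-ergodic.
   Context: $\mathcal{A}$ is a finite alphabet, and $\mathbb{N}$ includes $0$. $\mathcal{A}^{\mathbb{Z}}$ has the product topology and the shift $\sigma$, $(\sigma x)_j=x_{j+1}$. A one-dimensional subshift is a closed $\sigma$-invariant set $X\subset\mathcal{A}^{\mathbb{Z}}$; it is a shift of finite type (SFT) if it is the set of all sequences in which no pattern from some finite list of forbidden words appears. A cellular automaton (CA) $(X,\phi)$ is a subshift $X$ with a continuous map $\phi:X\to X$ commuting with $\sigma$. With $W_m=[-m,m]\cap\mathbb{Z}$, put $B_n(x)=\{y\in X: y_{W_n}=x_{W_n}\}$ and $O_m(x)=\{y\in X: (\phi^i y)_{W_m}=(\phi^i x)_{W_m}\ \forall i\ge0\}$. A point $x$ is a $\mu$-equicontinuity point of $\phi$ if for all $m\in\mathbb{N}$, $\lim_{n\to\infty}\mu(B_n(x)\cap O_m(x))/\mu(B_n(x))=1$ (in particular $\mu(B_n(x))>0$ for all $n$). $(X,\phi)$ is $\mu$-equicontinuous if $\mu$-almost every $x\in X$ is a $\mu$-equicontinuity point. $\phi^i\mu$ is the push-forward of $\mu$ under $\phi^i$. Weak convergence is convergence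 of integrals of continuous functions; the weak limit $\mu_\infty$ exists under the stated hypotheses (and is $\phi$-invariant). $\phi$-ergodic means $\phi$-invariant and ergodic for $\phi$. Two measure preserving transformations are isomorphic (measurably) if, modulo null sets, there is an invertible measure preserving map between the spaces, with measure preserving inverse, intertwining the transformations. A cyclic permutation on a finite set is considered with the uniform probability measure on that set. *)

(* Defs.v *)
From HB Require Import structures.
From mathcomp Require Import all_boot all_order all_algebra all_fingroup.
From mathcomp Require Import all_classical all_reals all_analysis.

Set Implicit Arguments.
Unset Strict Implicit.
Unset Printing Implicit Defensive.
Import Order.TTheory GRing.Theory Num.Theory.
Import numFieldNormedType.Exports.

Local Open Scope classical_set_scope.
Local Open Scope ring_scope.

Definition config (A : finType) : topologicalType :=
  {ptws int -> discrete_topology A}.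

Definition shift (A : finType) (x : config A) : config A := fun j => x (j + 1).

(* Measurable spaces of MathComp-Analysis are pointed, hence the field
   [subshift_nonempty]; it loses nothing for subshifts that carry a
   probability measure. *)
Record subshift (A : finType) := Subshift {
  subshift_set :> set (config A);
  subshift_closed : closed subshift_set;
  subshift_shift : @shift A @` subshift_set = subshift_set;
  subshift_nonempty : subshift_set !=set0
}.

Section subshift_space.
Context {A : finType} (X : subshift A).

Definition subshift_space : Type := set_type (subshift_set X).

Let space_point : subshift_space :=
  exist _ (projT1 (cid (subshift_nonempty X)))
    (mem_set (projT2 (cid (subshift_nonempty X)))).

HB.instance Definition _ :=
  Topological.copy subshift_space (set_type (subshift_set X)).
HB.instance Definition _ := isPointed.Build subshift_space space_point.
HB.instance Definition _ := Measurable.copy subshift_space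
  (g_sigma_algebraType (@open subshift_space)).

Definition coords (x : subshift_space) : config A := set_val x.

Lemma shift_in (x : subshift_space) : shift (coords x) \in subshift_set X.
Proof.
apply/mem_set; rewrite -(subshift_shift X).
by exists (coords x) => //; exact: set_valP.
Qed.

Definition subshift_map (x : subshift_space) : subshift_space :=
  exist _ (shift (coords x)) (shift_in x).

End subshift_space.

Definition appears_at (A : finType) (w : seq A) (x : config A) (i : int) :=
  [seq (x (i + k%:Z) : A) | k <- iota 0 (size w)] = w.

Definition shift_of_finite_type (A : finType) (X : subshift A) :=
  exists forbidden : seq (seq A),
    subshift_set X =
    [set x | forall w, w \in forbidden -> forall i, ~ appears_at w x i].

Definition cellular_automaton (A : finType) (X : subshift A)
    (phi : subshift_space X -> subshift_space X) :=
  continuous phi /\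
  forall x, phi (subshift_map x) = subshift_map (phi x).

Section dynamics.
Context {R : realType}.

Definition measure_preserving d1 d2 (T1 : measurableType d1)
    (T2 : measurableType d2) (mu1 : set T1 -> \bar R) (mu2 : set T2 -> \bar R)
    (f : T1 -> T2) :=
  measurable_fun [set: T1] f /\
  forall B, measurable B -> pushforward mu1 f B = mu2 B.

Definition invariant_measure d (T : measurableType d) (mu : set T -> \bar R)
    (f : T -> T) := measure_preserving mu mu f.

Definition ergodic d (T : measurableType d) (mu : set T -> \bar R)
    (f : T -> T) :=
  invariant_measure mu f /\
  forall B, measurable B -> f @^-1` B = B -> mu B = 0%E \/ mu B = 1%E.

(* Maps defined modulo null sets are represented by everywhere defined
   measurable maps, with the identities holding almost everywhere. *)
Definition isomorphic d1 d2 (T1 : measurableType d1) (T2 : measurableType d2)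
    (mu1 : set T1 -> \bar R) (f1 : T1 -> T1)
    (mu2 : set T2 -> \bar R) (f2 : T2 -> T2) :=
  [/\ invariant_measure mu1 f1, invariant_measure mu2 f2 &
    exists (h : T1 -> T2) (g : T2 -> T1),
      [/\ measure_preserving mu1 mu2 h, measure_preserving mu2 mu1 g,
          g \o h = id %[ae mu1], h \o g = id %[ae mu2] &
          h \o f1 = f2 \o h %[ae mu1]]].

End dynamics.

Definition discrete_space (F : finType) (x0 : F) : Type := F.

Section discrete_space.
Context {F : finType} (x0 : F).
HB.instance Definition _ := Choice.copy (discrete_space x0) F.
HB.instance Definition _ := isPointed.Build (discrete_space x0) x0.
HB.instance Definition _ := @isMeasurable.Build default_measure_display
  (discrete_space x0) discrete_measurable discrete_measurable0
  discrete_measurableC discrete_measurableU.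
End discrete_space.

Definition uniform_measure (R : realType) (F : finType) (x0 : F)
    (B : set (discrete_space x0)) : \bar R :=
  ((#|F|%:R^-1)%:E * counting B)%E.

Definition cyclic_perm (F : finType) (p : {perm F}) :=
  forall x y : F, y \in porbit p x.

Definition isomorphic_to_cyclic_permutation (R : realType) d
    (T : measurableType d) (mu : set T -> \bar R) (f : T -> T) :=
  exists (F : finType) (x0 : F) (p : {perm F}),
    cyclic_perm p /\
    isomorphic mu f (@uniform_measure R F x0)
      (p : discrete_space x0 -> discrete_space x0).

Section equicontinuity.
Context {R : realType} {A : finType} {X : subshift A}.
Local Notation T := (subshift_space X).
Implicit Types (mu : probability T R) (phi : T -> T).

Definition agree_on_window (m : nat) (x y : T) :=
  forall j : int, `|j| <= m%:Z -> coords x j = coords y j.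

Definition window_ball (n : nat) (x : T) : set T :=
  [set y | agree_on_window n y x].

Definition orbit_ball phi (m : nat) (x : T) : set T :=
  [set y | forall i : nat, agree_on_window m (iter i phi y) (iter i phi x)].

Definition equicontinuity_point mu phi (x : T) :=
  (forall n, (0 < mu (window_ball n x))%E) /\
  forall m : nat,
    fine (mu (window_ball n x `&` orbit_ball phi m x)) /
      fine (mu (window_ball n x)) @[n --> \oo] --> (1 : R).

Definition mu_equicontinuous mu phi :=
  {ae mu, forall x, equicontinuity_point mu phi x}.

Definition cesaro_mean mu phi (n : nat) (B : set T) : \bar R :=
  ((n%:R^-1)%:E * \sum_(1 <= i < n.+1) pushforward mu (iter i phi) B)%E.

Definition weak_limit (nu : nat -> set T -> \bar R) (nu_oo : set T -> \bar R) :=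
  forall f : T -> R, continuous f ->
    (\int[nu n]_x (f x)%:E)%E @[n --> \oo] --> (\int[nu_oo]_x (f x)%:E)%E.

End equicontinuity.

(* Main.v *)
(** Curtis-Hedlund-Lyndon gives [phi] a radius [r].  If [x] is a
    mu-equicontinuity point, the set [O] of points sharing the orbit of the
    central window of [x] of radius [r] has positive mass, so by recurrence
    under the shift it contains some [y] together with a translate of [y] by
    [k >= r].  The space-time strip of [y] between the two equal columns evolves
    autonomously on finitely many states, so the column of [x], hence of every
    point of [O], is eventually periodic in time, with some period [p].
    By shift invariance of [mu] the same holds with the same mass at every
    coordinate, and this passes to the limit: for each [j], [mu_oo] charges the
    points whose [j]-th cell is [p]-periodic.  These form a forward invariant
    set, so if [mu_oo] is ergodic then [phi^p = id] almost everywhere.  Then the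
    orbit of a cylinder of positive mass consists of [p] preimages and has full
    mass, so its mass is at least [1 / p]; shrinking cylinders yield an atom,
    and [mu_oo] is uniform on the cycle of that atom. *)

Require Import Defs.
From HB Require Import structures.
From mathcomp Require Import all_boot all_order all_algebra all_fingroup.
From mathcomp Require Import all_classical all_reals all_analysis.
From mathcomp Require Import zify lra.

Set Implicit Arguments.
Unset Strict Implicit.
Unset Printing Implicit Defensive.
Import Order.TTheory GRing.Theory Num.Theory.
Import numFieldNormedType.Exports.

Local Open Scope classical_set_scope.
Local Open Scope ring_scope.

(** * Uniform measure on a finite set, and ergodicity of cyclic permutations *)

Lemma counting_finType (R : realType) (F : finType) (B : set F) :
  counting B = (#|[pred y | y \in B]|%:R : R)%:E.
Proof.
have finB : finite_set B by exact: finite_finset.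
rewrite /counting asboolT//; congr (_%:R%:E); rewrite cardE.
apply: perm_size; apply: uniq_perm; rewrite ?enum_uniq ?finmap.fset_uniq//.
by move=> y; rewrite mem_enum inE in_fset_set.
Qed.

Section uniform.
Context (R : realType) (F : finType) (x0 : F).
Local Open Scope ereal_scope.

Lemma uniform_measureE (B : set F) :
  @uniform_measure R F x0 B = \sum_(y : F | y \in B) (#|F|%:R^-1)%:E.
Proof.
rewrite /uniform_measure counting_finType sumEFin -EFinM; congr EFin.
by rewrite sumr_const mulr_natr.
Qed.

Lemma card_gt0_point : (0 < #|F|)%N.
Proof. by apply/card_gt0P; exists x0. Qed.

Lemma uniform_measure0 : @uniform_measure R F x0 set0 = 0.
Proof. by rewrite uniform_measureE big1// => y; rewrite in_set0. Qed.

Lemma uniform_measureT : @uniform_measure R F x0 [set: F] = 1.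
Proof.
rewrite /uniform_measure counting_finType -EFinM; congr EFin.
have -> : #|[pred y | y \in [set: F]]| = #|F|.
  by apply: eq_card => y; rewrite !inE; exact/asboolP.
by rewrite mulVf// pnatr_eq0 -lt0n card_gt0_point.
Qed.

Lemma uniform_measure_gt0 (B : set F) y : B y -> 0 < @uniform_measure R F x0 B.
Proof.
move=> By; rewrite /uniform_measure counting_finType -EFinM lte_fin.
rewrite mulr_gt0 ?invr_gt0 ?ltr0n ?card_gt0_point//.
by apply/card_gt0P; exists y; rewrite inE.
Qed.

Lemma uniform_measure_perm (p : {perm F}) (B : set F) :
  @uniform_measure R F x0 (p @^-1` B) = @uniform_measure R F x0 B.
Proof.
rewrite !uniform_measureE [RHS](reindex_inj (@perm_inj _ p)).
by apply: eq_bigl => y; apply/idP/idP => /set_mem ?; apply/mem_set.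
Qed.

Lemma uniform_invariant (p : {perm F}) :
  invariant_measure (@uniform_measure R F x0)
    (p : discrete_space x0 -> discrete_space x0).
Proof. by split=> // B _; exact: uniform_measure_perm. Qed.

End uniform.

(** An invariant set pulls back along [g] to a [p]-invariant subset of [F], which is empty or
    everything because [p] has a single orbit. *)
Lemma isomorphic_to_cyclic_permutation_ergodic (R : realType) d
    (T : measurableType d) (mu : probability T R) (f : T -> T) :
  isomorphic_to_cyclic_permutation mu f -> ergodic mu f.
Proof.
move=> [F [x0 [p [pcyc [invf _ [h [g [[mh hE] [mg gE] gh hg hf]]]]]]]].
split=> // B mB fB.
(* The almost-everywhere conjugacy becomes exact on [F]: the fibre of [h] over [y] has positive
   mass, so it meets the complement of any null set. *)
have gp y : f (g y) = g (p y).
  (* Invariance of [mu] transports [g \o h = id] from almost every [x] to the image [f x]. *)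
  have [Nf [mNf Nf0 NfP]] : {ae mu, forall x, g (h (f x)) = f x}.
    case: gh => N [mN N0 sN].
    exists (f @^-1` N); split.
    - by have := invf.1 measurableT _ mN; rewrite setTI.
    - by rewrite -N0; exact: (invf.2 _ mN).
    - by move=> x /= nx; apply: sN => /= H; apply: nx; exact: H.
  have [N [mN N0 NP]] : {ae mu, forall x,
      [/\ g (h x) = x, h (f x) = p (h x) & g (h (f x)) = f x]}.
    have afx : {ae mu, forall x, g (h (f x)) = f x} by exists Nf.
    move: gh hf afx; apply: filterS3 => x H1 H2 H3; split.
    - exact: H1.
    - exact: H2.
    - exact: H3.
  have [x [hx Nx]] : exists x, h x = y /\ ~ N x.
    apply: contrapT => /forallNP H.
    have : (@uniform_measure R F x0 [set y] <= 0)%E.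
      rewrite -(hE [set y])// -[leRHS]N0 /pushforward; apply: le_measure.
      - by have := mh measurableT [set y] I; rewrite setTI inE.
      - by rewrite inE.
      - by move=> x /= hx; apply: contrapT => Nx; apply: (H x).
    by rewrite leNgt (@uniform_measure_gt0 _ _ x0 _ y).
  have [e1 e2 e3] : [/\ g (h x) = x, h (f x) = p (h x) & g (h (f x)) = f x].
    by apply: contrapT => H; exact/Nx/NP.
  by rewrite -hx e1 -e3 e2.
rewrite -gE// /pushforward.
have gBp y : (g @^-1` B) (p y) <-> (g @^-1` B) y.
  have e : (f @^-1` B) (g y) = B (g y) by rewrite fB.
  by rewrite /preimage/= -gp -[X in _ <-> X]e.
have gBi y i : (g @^-1` B) ((p ^+ i)%g y) <-> (g @^-1` B) y.
  elim: i => [|i IH]; first by rewrite expg0 perm1.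
  by rewrite expgSr permM gBp.
have [[y By]|nB] := pselect (exists y, (g @^-1` B) y); [right|left].
  rewrite (_ : g @^-1` B = setT) ?uniform_measureT//.
  apply/seteqP; split=> // z _.
  by have /porbitP [i ->] := pcyc y z; apply/gBi.
rewrite (_ : g @^-1` B = set0) ?uniform_measure0//.
by rewrite -subset0 => y By; apply: nB; exists y.
Qed.

(** * Iterates, invariant measures and ergodicity *)

Lemma full_measure_ae (R : realType) d (T : measurableType d)
    (mu : probability T R) (A : set T) :
  measurable A -> mu A = 1%E -> {ae mu, forall x, A x}.
Proof.
move=> mA A1; exists (~` A); split=> //; first exact: measurableC.
by rewrite probability_setC// A1 subee.
Qed.

Lemma iter_modn (T : Type) (f : T -> T) p i x :
  iter p f x = x -> iter i f x = iter (i %% p) f x.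
Proof.
move=> fx.
by rewrite {1}(divn_eq i p) addnC iterD iterM [iter (_ %/ _) _ _]iter_fix.
Qed.

Section measurable_iter.
Context d (T : measurableType d) (f : T -> T).
Hypothesis mf : measurable_fun [set: T] f.

Lemma measurable_iter i : measurable_fun [set: T] (iter i f).
Proof.
elim: i => [|i IH]; first exact: measurable_id.
exact: (measurableT_comp mf IH).
Qed.

Lemma measurable_iter_preimage i (B : set T) :
  measurable B -> measurable (iter i f @^-1` B).
Proof.
by move=> mB; have := measurable_iter i measurableT mB; rewrite setTI.
Qed.

End measurable_iter.

Section invariant.
Context (R : realType) d (T : measurableType d) (mu : probability T R).
Variable f : T -> T.
Hypothesis invf : invariant_measure mu f.
Local Open Scope ereal_scope.

Lemma invariant_iter i (B : set T) :
  measurable B -> mu (iter i f @^-1` B) = mu B.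
Proof.
elim: i B => [|i IH] B mB //.
have mfB : measurable (f @^-1` B) by exact: (measurable_iter_preimage invf.1 1).
by rewrite -(invf.2 _ mB) /pushforward -(IH _ mfB).
Qed.

End invariant.

Section ergodic.
Context (R : realType) d (T : measurableType d) (mu : probability T R).
Variable f : T -> T.
Hypothesis ergf : ergodic mu f.
Local Open Scope ereal_scope.

(* The hitting set V only satisfies [f @^-1` V `<=` V]; the intersection of its
   preimages is exactly invariant and has the same measure. *)
Lemma ergodic_hitting (C : set T) : measurable C -> 0 < mu C ->
  mu (\bigcup_i (iter i f @^-1` C)) = 1.
Proof.
move=> mC C0; set V := \bigcup_i _.
have invf := ergf.1.
have mV : measurable V.
  by apply: bigcup_measurable => i _; exact: (measurable_iter_preimage invf.1).
have mVi i : measurable (iter i f @^-1` V).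
  by exact: (measurable_iter_preimage invf.1).
have fV x : V (f x) -> V x.
  move=> [i _ Cx]; exists i.+1 => //.
  by rewrite /preimage /mkset iterSr; exact: Cx.
pose D := \bigcap_n (iter n f @^-1` V).
have mD : measurable D by exact: bigcap_measurable.
have DV : mu D = mu V.
  have E : cst (mu V) = mu \o (fun n => iter n f @^-1` V).
    by apply/funext => n /=; rewrite (invariant_iter invf).
  have H : cst (mu V) x @[x --> \oo] --> mu D.
    rewrite E; apply: nonincreasing_cvg_mu => //.
      by rewrite ltey_eq fin_num_measure.
    apply/nonincreasing_seqP => n; apply/subsetPset => x /=.
    exact: fV.
  exact: (cvg_unique (@ereal_hausdorff R) H (cvg_cst _)).
have fD : f @^-1` D = D.
  apply/seteqP; split=> [x Dx n _|x Dx n _].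
    by apply: (fV (iter n f x)); rewrite -iterS iterSr; exact: Dx n I.
  by rewrite /preimage /mkset -iterSr; exact: Dx n.+1 I.
have : 0 < mu D.
  rewrite DV; apply: lt_le_trans C0 _; apply: le_measure; rewrite ?inE//.
  by move=> x Cx; exists 0%N.
by case: (ergf.2 D mD fD) => [->|]; rewrite ?ltxx// DV.
Qed.

(** The preimages of [P] increase and all have mass [mu P], while their union is the hitting set of
    [P], of mass 1. *)
Lemma ergodic_forward_invariant (P : set T) :
  measurable P -> P `<=` f @^-1` P -> 0 < mu P -> mu P = 1.
Proof.
move=> mP Pf P0; rewrite -(ergodic_hitting mP P0).
have mPi i : measurable (iter i f @^-1` P).
  exact: (measurable_iter_preimage ergf.1.1).
have E : cst (mu P) = mu \o (fun n => iter n f @^-1` P).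
  by apply/funext => n /=; rewrite (invariant_iter ergf.1).
have H : cst (mu P) x @[x --> \oo] --> mu (\bigcup_n (iter n f @^-1` P)).
  rewrite E; apply: nondecreasing_cvg_mu => //; first exact: bigcup_measurable.
  apply/nondecreasing_seqP => n; apply/subsetPset => x /=.
  exact: Pf.
exact: (cvg_unique (@ereal_hausdorff R) (cvg_cst _) H).
Qed.

(** By periodicity the first [p] preimages of [C] already cover its hitting set up to a null set,
    and each has mass [mu C]. *)
Lemma ergodic_periodic_bound (C : set T) p : (0 < p)%N ->
  {ae mu, forall x, iter p f x = x} -> measurable C -> 0 < mu C ->
  1 <= p%:R%:E * mu C.
Proof.
move=> p0 [N [mN N0 NP]] mC C0.
have mCi i : measurable (iter i f @^-1` C).
  exact: (measurable_iter_preimage ergf.1.1).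
pose W := \big[setU/set0]_(i < p) (iter i f @^-1` C).
have mW : measurable W by exact: bigsetU_measurable.
rewrite -(ergodic_hitting mC C0).
apply: (@le_trans _ _ (mu (W `|` N))).
  apply: le_measure; rewrite ?inE; first exact: bigcup_measurable.
    exact: measurableU.
  move=> x [i _ Cx]; have [Nx|nNx] := pselect (N x); first by right.
  left; rewrite /W -(bigcup_mkord p (fun i => iter i f @^-1` C)).
  exists (i %% p)%N; first by rewrite /= ltn_mod.
  rewrite /preimage/= -iter_modn//.
  by apply: contrapT => H; exact/nNx/NP.
rewrite measureU0//.
apply: (le_trans (Boole_inequality mu (fun i (_ : (i < p)%N) => mCi i))).
have -> : \sum_(i < p) mu (iter i f @^-1` C) = \sum_(i < p) mu C.
  by apply: eq_bigr => i _; exact: (invariant_iter ergf.1).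
by rewrite mule_natl big_const_ord iter_addr addr0.
Qed.

End ergodic.

(** * Ergodic measures with a periodic atom *)

Lemma minimal_period (T : Type) (f : T -> T) p x :
  (0 < p)%N -> iter p f x = x ->
  exists q, [/\ (0 < q)%N, iter q f x = x &
    forall i j, (i < j < q)%N -> iter i f x <> iter j f x].
Proof.
move=> p0 fp.
have exq : exists n, (0 < n)%N && `[< iter n f x = x >].
  by exists p; rewrite p0; exact/asboolP.
have [q /andP[q0 /asboolP fq] qmin] := ex_minnP exq.
exists q; split=> // i j /andP[ij jq] e.
have jq' := ltnW jq.
(* If the orbit met itself at times [i < j < q], then [q - j] further steps would bring [x] back
   already at time [q - j + i < q]. *)
suff /qmin : (0 < q - j + i)%N && `[< iter (q - j + i) f x = x >].
  by rewrite leqNgt; apply/negP/negPn; rewrite -ltn_subRL subKn.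
rewrite addn_gt0 subn_gt0 jq/=; apply/asboolP.
by rewrite iterD e -iterD subnK.
Qed.

Section atom.
Context (R : realType) d (T : measurableType d) (mu : probability T R).
Variables (f : T -> T) (x : T) (q' : nat).
Let q := q'.+1.
Hypothesis ergf : ergodic mu f.
Hypothesis mset1 : forall y : T, measurable [set y].
Hypothesis mux : (0 < mu [set x])%E.
Hypothesis fqx : iter q f x = x.
Hypothesis finj : forall i j, (i < j < q)%N -> iter i f x <> iter j f x.
Local Open Scope ereal_scope.

Let g (i : 'I_q) : T := iter i f x.
(** The inverse of [g] on the orbit; the default [ord0] is taken off the orbit, which turns out to
    be a null set. *)
Let h (y : T) : 'I_q := odflt ord0 [pick i | `[< y = g i >]].

Let g_inj : injective g.
Proof.
move=> i j gij; apply/val_inj => /=; apply/eqP.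
case: ltngtP => // ij.
  by have := @finj i j; rewrite ij ltn_ord => /(_ isT).
by have := @finj j i; rewrite ij ltn_ord => /(_ isT); case.
Qed.

Let gK i : h (g i) = i.
Proof.
rewrite /h; case: pickP => [j /asboolP /g_inj //|/(_ i)].
by move/negP; case; exact/asboolP.
Qed.

Let fg i : f (g i) = g (ordS i).
Proof. by rewrite /g -iterS (iter_modn _ fqx). Qed.

Let range_fin (B : set T) : B `&` range g =
  \big[setU/set0]_(i < q | g i \in B) [set g i].
Proof.
rewrite -bigcup_seq_cond; apply/seteqP.
split=> [y [By [i _ iy]]|y [i /andP[_ /set_mem Bi]] ->].
  exists i => //=; rewrite mem_index_enum/=.
  by apply/mem_set; rewrite iy.
by split=> //; exists i.
Qed.

Let mrange : measurable (range g).
Proof. by rewrite -[range g]setTI range_fin; exact: bigsetU_measurable. Qed.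

Let mu_range : mu (range g) = 1.
Proof.
apply: (ergodic_forward_invariant ergf mrange).
  by move=> y [i _ <-]; exists (ordS i) => //; rewrite -fg.
apply: lt_le_trans mux _; apply: le_measure; rewrite ?inE//.
by move=> y ->; exists ord0.
Qed.

Let ae_range : {ae mu, forall y, range g y}.
Proof. exact: full_measure_ae. Qed.

(** The mass of a point cannot decrease along the orbit, since a point lies in the preimage of its
    image; as the orbit returns to [x], all these masses are equal. *)
Let mu_orbit i : mu [set iter i f x] = mu [set x].
Proof.
have le1 j : mu [set iter j f x] <= mu [set iter j.+1 f x].
  rewrite -[leRHS](ergf.1.2 _ (mset1 _)); apply: le_measure; rewrite ?inE//.
    by have := ergf.1.1 measurableT _ (mset1 (iter j.+1 f x)); rewrite setTI.
  by move=> y ->.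
have mono j k : (j <= k)%N -> mu [set iter j f x] <= mu [set iter k f x].
  by move/subnK <-; elim: (k - j)%N => // n IH; exact: le_trans IH (le1 _).
apply/le_anti/andP; split; last exact: (mono 0%N).
(* [i * q] is a multiple of the period that is at least [i]. *)
have := mono i (i * q)%N (leq_pmulr _ (ltn0Sn q')).
by rewrite iterM (iter_fix _ fqx).
Qed.

Let mu_finite (B : set T) : measurable B ->
  mu B = \sum_(i < q | g i \in B) (q%:R^-1)%:E.
Proof.
have muE (C : set T) : measurable C ->
    mu C = \sum_(i < q | g i \in C) mu [set x].
  move=> mC; transitivity (mu (C `&` range g)).
    rewrite (measureDI mu mC mrange) [X in X + _](_ : _ = 0) ?add0e//.
    have r0 : mu (~` range g) = 0 by rewrite probability_setC// mu_range subee.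
    apply/le_anti; rewrite measure_ge0 andbT -[leRHS]r0.
    apply: le_measure; rewrite ?inE; first exact: measurableD.
      exact: measurableC.
    by move=> y [].
  rewrite range_fin measure_bigsetU_ord//.
    by apply: eq_bigr => i _; exact: mu_orbit.
  by move=> i j _ _ [y [-> /g_inj]].
move=> mB; rewrite muE//; apply: eq_bigr => _ _.
(* Total mass 1 shared equally by [q] points determines the mass of [x]. *)
have := muE _ measurableT; rewrite probability_setT.
rewrite (eq_bigl xpredT); last by move=> i; exact/mem_set.
rewrite -(fineK (fin_num_measure mu _ (mset1 x))) sumEFin => -[].
rewrite sumr_const card_ord => e; congr EFin.
have q0 : (q%:R != 0 :> R)%R by rewrite pnatr_eq0.
by apply: (mulIf q0); rewrite mulVf// mulr_natr -e.
Qed.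

Let pushforward_orbit (B : set T) : measurable B ->
  pushforward (@uniform_measure R 'I_q ord0) g B = mu B.
Proof.
move=> mB; rewrite mu_finite// /pushforward uniform_measureE card_ord.
by apply: eq_bigl => i; apply/idP/idP => /set_mem ?; exact/mem_set.
Qed.

Let measurable_h : measurable_fun [set: T] (h : T -> discrete_space ord0).
Proof.
move=> _ B _; rewrite setTI.
have h0 y : ~ range g y -> h y = ord0.
  move=> nry; rewrite /h; case: pickP => // i /asboolP yi.
  by case: nry; exists i.
(* The points off the orbit belong to the preimage exactly when [B] contains the default value. *)
have -> : h @^-1` B = \bigcup_(i in B) [set g i] `|`
    (if pselect (B ord0) then ~` range g else set0).
  apply/seteqP; split=> y.
    move=> By; have [[i _ iy]|nry] := pselect (range g y).
      by left; exists i => //; move: By; rewrite /preimage /mkset -iy gK.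
    by right; move: By; rewrite /preimage /mkset h0//; case: pselect.
  move=> [[i Bi ->]|]; first by rewrite /preimage /mkset gK.
  by case: pselect => // B0 nry; rewrite /preimage /mkset h0.
apply: measurableU.
  by apply: fin_bigcup_measurable => //; exact: finite_finset.
by case: pselect => B0 /=; [exact: measurableC|exact: measurable0].
Qed.

Lemma ergodic_atom_isomorphic : isomorphic_to_cyclic_permutation mu f.
Proof.
exists 'I_q, ord0, (perm (@ordS_inj q)); split.
  have pE k i : val ((perm (@ordS_inj q) ^+ k)%g i) = ((i + k) %% q)%N.
    elim: k => [|k IH]; first by rewrite expg0 perm1 addn0 modn_small.
    by rewrite expgSr permM permE /= IH addnS -addn1 modnDml addn1.
  (* The [k]-th power adds [k] modulo [q]; [j + (q - i)] is congruent to [j - i] without truncated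
     subtraction. *)
  move=> i j; apply/porbitP; exists (j + (q - i))%N; apply/val_inj.
  by rewrite pE addnCA subnKC ?modnDr ?modn_small// ltnW.
split; [exact: ergf.1|exact: uniform_invariant|].
exists h, g; split.
- split=> [|B _]; first exact: measurable_h.
  rewrite /pushforward -pushforward_orbit; last first.
    have := measurable_h measurableT
      (I : measurable (B : set (discrete_space ord0))).
    by rewrite setTI.
  rewrite /pushforward -comp_preimage (_ : h \o g = id)//.
  exact/funext.
- by split=> // B mB; exact: pushforward_orbit.
- by apply: filterS ae_range => _ [i _ <-] _ /=; rewrite gK.
- exists set0; split=> //; first exact: uniform_measure0.
  by move=> i /= []; rewrite gK.
- by apply: filterS ae_range => _ [i _ <-] _ /=; rewrite fg !gK permE.
Qed.

End atom.

(** * Topology of the subshift space *)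

Section topology.
Context (A : finType) (X : subshift A).
Local Notation T := (subshift_space X).

Lemma coords_near (x : T) (j : int) :
  \forall y \near x, coords y j = coords x j.
Proof.
have c1 : continuous (@coords A X) by exact: initial_continuous.
have c2 : continuous (fun z : config A => z j).
  exact: (@proj_continuous _ (fun=> discrete_topology A) j).
have := @continuous_comp _ _ _ _ _ _ (c1 x) (c2 (coords x)).
move=> /(_ [set coords x j]); apply.
by rewrite nbhs_principalE.
Qed.

(** Tychonoff makes the closed set [X] compact in the full product; a filter on the subtype is
    pushed forward along [coords], and the cluster point found there is lifted back. *)
Lemma subshift_compact : compact [set: T].
Proof.
have cX : compact (subshift_set X).
  apply: (subclosed_compact (subshift_closed (s := X))
    (tychonoff (I := int) (T := fun=> discrete_topology A)
     (A := fun=> setT) _)) => //.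
  by move=> i; apply: finite_compact; exact: finite_finset.
move=> F FF _.
have FX : F (@coords A X @^-1` subshift_set X).
  by apply: filterS filterT => x _; exact: set_valP.
have [x [Xx clx]] := cX (@coords A X @ F) _ FX.
exists (exist _ x (mem_set Xx)); split => // B C FB.
rewrite nbhsE => -[U [[V oV <-] Ux] UC].
have FcB : F (@coords A X @^-1` (@coords A X @` B)).
  by apply: filterS FB => b Bb; exists b.
have [_ [[b Bb <-] Vb]] := clx _ _ FcB (open_nbhs_nbhs (conj oV Ux)).
by exists b; split => //; exact: UC.
Qed.

End topology.

(** * Clopen sets, phrased as locally constant predicates *)

Definition locally_constant (S : topologicalType) (P : set S) :=
  forall x, \forall y \near x, P y <-> P x.

Lemma locally_constant_open (S : topologicalType) (P : set S) :
  locally_constant P -> open P.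
Proof.
by move=> lP; rewrite openE => x Px; apply: filterS (lP x) => y [_]; exact.
Qed.

Lemma locally_constant_forall (S : topologicalType) (P : nat -> set S) n :
  (forall i, locally_constant (P i)) ->
  locally_constant [set x | forall i, (i < n)%N -> P i x].
Proof.
move=> lP; elim: n => [|n IH] x; first exact: nearW.
apply: filterS2 (IH x) (lP n x) => y yn yx; split=> H i.
  rewrite ltnS leq_eqVlt => /predU1P[->|ni]; first by apply/yx/H.
  by apply: (yn.1 _ i ni) => k kn; apply: H; exact: ltnW.
rewrite ltnS leq_eqVlt => /predU1P[->|ni]; first by apply/yx/H.
by apply: (yn.2 _ i ni) => k kn; apply: H; exact: ltnW.
Qed.

(** This makes indicators of clopen sets admissible test functions for weak convergence. *)
Lemma locally_constant_indic (R : realType) (S : topologicalType) (P : set S) :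
  locally_constant P -> continuous (\1_P : S -> R).
Proof.
move=> lP x; apply: cvg_near_cst.
apply: filterS (lP x) => y yx; rewrite !indicE; congr (_%:R).
by congr nat_of_bool; apply/idP/idP; rewrite !inE => ?; apply/yx.
Qed.

Lemma measurable_forall d (S : measurableType d) (I : countType)
    (P : I -> set S) :
  (forall i, measurable (P i)) -> measurable [set x | forall i, P i x].
Proof.
move=> mP; have -> : [set x | forall i, P i x] = ~` \bigcup_i (~` P i).
  apply/seteqP; split=> x; first by move=> Px [i _]; apply; exact: Px.
  by move=> nPx i; apply: contrapT => H; apply: nPx; exists i.
apply: measurableC; apply: countable_bigcupT_measurable => // i.
exact: measurableC.
Qed.

(** * Measurability and the local rule of a cellular automaton *)

Section cellular_automaton.
Context (A : finType) (X : subshift A).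
Local Notation T := (subshift_space X).
Variable phi : T -> T.
Hypothesis caphi : cellular_automaton phi.
Local Notation sigma := (@subshift_map A X).

Lemma locally_constant_measurable (P : set T) :
  locally_constant P -> measurable P.
Proof. by move=> /locally_constant_open oP; exact: sub_sigma_algebra. Qed.

Lemma measurable_coord (B : set A) j : measurable [set x : T | B (coords x j)].
Proof.
apply: locally_constant_measurable => x.
by apply: filterS (coords_near x j) => y /= ->.
Qed.

Lemma subshift_space_ext (x y : T) :
  (forall j, coords x j = coords y j) -> x = y.
Proof. by move=> xy; apply/val_inj/funext. Qed.

Lemma measurable_window_ball n (x : T) : measurable (window_ball n x).
Proof.
apply: (@measurable_forall _ _ int) => j.
apply: locally_constant_measurable => y.
by apply: filterS (coords_near y j) => z /= ->.
Qed.

Lemma measurable_set1 (x : T) : measurable [set x].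
Proof.
have -> : [set x] = [set y : T | forall j, coords y j = coords x j].
  by apply/seteqP; split=> [y -> //|y]; exact: subshift_space_ext.
by apply: measurable_forall => j; exact: (measurable_coord [set coords x j]).
Qed.

Lemma continuous_iter i : continuous (iter i phi).
Proof.
elim: i => [|i IH] x; first exact: cvg_id.
by apply: continuous_comp; [exact: IH|exact: caphi.1].
Qed.

Lemma continuous_measurable_map : measurable_fun [set: T] phi.
Proof.
apply: (measurability (@open T)) => //.
move=> _ [U oU <-]; rewrite setTI; apply: sub_sigma_algebra.
by move/continuousP: caphi.1; exact.
Qed.

Lemma coords_iter_near (x : T) i j :
  \forall y \near x, coords (iter i phi y) j = coords (iter i phi x) j.
Proof. exact: (continuous_iter (x := x) (coords_near (iter i phi x) j)). Qed.

Lemma coords_iter_shift k (x : T) j :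
  coords (iter k sigma x) j = coords x (j + k%:Z).
Proof.
elim: k x j => [|k IH] x j; first by rewrite addr0.
by rewrite iterSr IH -[LHS]/(coords x (j + k%:Z + 1)) -addrA -PoszD addn1.
Qed.

Lemma iter_ca_shift k i (x : T) :
  iter i phi (iter k sigma x) = iter k sigma (iter i phi x).
Proof.
elim: k => //= k <-; elim: i => //= i ->; exact: caphi.2.
Qed.

(* By compactness of X * X: locally at (x, x) the value of phi at 0 is constant,
   and locally at (x, y) with x <> y a fixed coordinate separates the points. *)
Lemma local_radius_origin : exists r : nat, forall x y : T,
  (forall j : int, `|j| <= r%:Z -> coords x j = coords y j) ->
  coords (phi x) 0 = coords (phi y) 0.
Proof.
have /compact_near_coveringP cTT :=
  compact_setX (@subshift_compact A X) (@subshift_compact A X).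
pose P (n : nat) (xy : T * T) :=
  (forall j : int, `|j| <= n%:Z -> coords xy.1 j = coords xy.2 j) ->
  coords (phi xy.1) 0 = coords (phi xy.2) 0.
have [|r _ rP] := cTT nat \oo P _ _; last first.
  by exists r => x y; apply: (rP r (leqnn r) (x, y)).
move=> [x y] _ /=.
have [->|nxy] := pselect (x = y).
  pose U := [set z | coords (phi z) 0 = coords (phi y) 0].
  exists (U `*` U, setT).
    split; last exact: filterT.
    by exists (U, U) => //; split; exact: (coords_iter_near y 1 0).
  by move=> [z n] [[/= e1 e2] _] _ /=; rewrite e1 e2.
have [j nj] : exists j, coords x j <> coords y j.
  apply: contrapT => /forallNP H; apply: nxy; apply: subshift_space_ext => j.
  by apply: contrapT; exact: H.
pose V (z : T) := [set t : T | coords t j = coords z j].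
exists (V x `*` V y, [set n | absz j <= n]%N).
  split; last by exists (absz j).
  by exists (V x, V y) => //; split; exact: coords_near.
move=> [z n] [[/= e1 e2] jn] H /=; case: nj; rewrite -e1 -e2.
by apply: H; rewrite -abszE lez_nat.
Qed.

(** The value at cell [k] is the value at the origin after [k] shifts, which commute with [phi]. *)
Lemma local_radius : exists r : nat, forall (x y : T) (k : nat),
  (forall j : int, `|j| <= r%:Z -> coords x (j + k%:Z) = coords y (j + k%:Z)) ->
  coords (phi x) k%:Z = coords (phi y) k%:Z.
Proof.
have [r rP] := local_radius_origin; exists r => x y k xy.
rewrite -[k%:Z]add0r -!coords_iter_shift -!(iter_ca_shift k 1)/=.
by apply: rP => j jr; rewrite !coords_iter_shift xy.
Qed.

End cellular_automaton.

(** * Recurrence and eventually periodic columns *)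

Lemma recurrence (R : realType) d (S : measurableType d) (mu : probability S R)
    (f : S -> S) (Y : set S) :
  invariant_measure mu f -> measurable Y -> (0 < mu Y)%E ->
  exists k y, [/\ Y y & Y (iter k.+1 f y)].
Proof.
move=> invf mY Y0; apply: contrapT => nret.
have mYi i : measurable (iter i f @^-1` Y).
  by exact: (measurable_iter_preimage invf.1).
pose V := \bigcup_i (iter i f @^-1` Y).
have mV : measurable V by exact: bigcup_measurable.
have mfV : measurable (f @^-1` V) by exact: (measurable_iter_preimage invf.1 1).
have fV : f @^-1` V `<=` V.
  by move=> x [i _ Yi]; exists i.+1 => //; rewrite /preimage /mkset iterSr.
have : (mu Y <= mu (V `\` f @^-1` V))%E.
  apply: le_measure; rewrite ?inE//; first exact: measurableD.
  move=> y Yy; split; first by exists 0%N.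
  by move=> [k _ Yk]; apply: nret; exists k, y; rewrite iterSr.
rewrite measureD//; last by rewrite ltey_eq fin_num_measure.
rewrite (_ : V `&` f @^-1` V = f @^-1` V); last by apply/setIidPr.
rewrite [X in (_ - X)%E](invariant_iter invf 1)// subee ?fin_num_measure//.
by rewrite leNgt Y0.
Qed.

Section eventually_periodic.
Context (A : finType) (X : subshift A).
Local Notation T := (subshift_space X).
Variable phi : T -> T.
Hypothesis caphi : cellular_automaton phi.
Local Notation sigma := (@subshift_map A X).

(** [q] bounds the preperiod, [p] is a period, not necessarily the least; [q = 0] means periodicity
    from time 0 on. *)
Definition eventually_periodic_at (q p : nat) (j : int) : set T :=
  [set x | forall i, (q <= i)%N ->
     coords (iter (i + p) phi x) j = coords (iter i phi x) j].

Variable r : nat.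
Hypothesis rP : forall (x y : T) (k : nat),
  (forall j : int, `|j| <= r%:Z -> coords x (j + k%:Z) = coords y (j + k%:Z)) ->
  coords (phi x) k%:Z = coords (phi y) k%:Z.

(* If the columns around 0 and k agree at all times, the pattern on [-r, k + r]
   at time i determines the one at time i + 1: phi fixes the cells of [0, k],
   and the remaining cells are copies of some of these. *)
Lemma equal_columns_eventually_periodic (y : T) (k : nat) : (r <= k)%N ->
  (forall i (l : int), `|l| <= r%:Z ->
    coords (iter i phi y) (l + k%:Z) = coords (iter i phi y) l) ->
  exists q p, (0 < p)%N /\ eventually_periodic_at q p 0 y.
Proof.
move=> rk col.
pose same i j := forall l : int, - r%:Z <= l <= k%:Z + r%:Z ->
  coords (iter i phi y) l = coords (iter j phi y) l.
have sameS i j : same i j -> same i.+1 j.+1.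
  move=> sij.
  have inner (t : nat) : (t <= k)%N ->
      coords (iter i.+1 phi y) t%:Z = coords (iter j.+1 phi y) t%:Z.
    move=> tk; apply: rP => l; rewrite ler_norml => /andP[l1 l2].
    by apply: sij; lia.
  move=> l /andP[l1 l2].
  have [l0|l0] := ltP l 0.
    rewrite -(col i.+1 l) -?(col j.+1 l); [|lia|lia].
    have -> : l + k%:Z = (absz (l + k%:Z)%R)%:Z by lia.
    by apply: inner; lia.
  have [lk|lk] := leP l k%:Z.
    have -> : l = (absz l)%:Z by lia.
    by apply: inner; lia.
  rewrite -(subrK k%:Z l) (col i.+1) ?(col j.+1); [|lia|lia].
  have -> : l - k%:Z = (absz (l - k%:Z)%R)%:Z by lia.
  by apply: inner; lia.
have sameD t i j : same i j -> same (i + t)%N (j + t)%N.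
  by elim: t => [|t IH] sij; rewrite ?addn0// !addnS; exact/sameS/IH.
pose N := (k + r + r).+1.
pose s (i : nat) : {ffun 'I_N -> A} :=
  [ffun l : 'I_N => coords (iter i phi y) (l%:Z - r%:Z) : A].
(* Pigeonhole: the strip [[-r, k + r]] has [N] cells, hence finitely many patterns, and one of them
   recurs. *)
have [i [j [ij sij]]] : exists i j, (i < j)%N /\ s i = s j.
  apply: contrapT => H.
  have inj : injective (fun i : 'I_(#|{ffun 'I_N -> A}|).+1 => s i).
    move=> a b sab; apply/val_inj/eqP; case: ltngtP => // ab; case: H.
      by exists a, b.
    by exists b, a.
  by have := leq_card _ inj; rewrite card_ord ltnn.
have sm : same i j.
  move=> l /andP[l1 l2].
  have lN : (absz (l + r%:Z)%R < N)%N by rewrite /N; lia.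
  have /ffunP/(_ (Ordinal lN)) := sij; rewrite !ffunE /=.
  by have -> : (absz (l + r%:Z)%R)%:Z - r%:Z = l by lia.
exists i, (j - i)%N; split; first by rewrite subn_gt0.
move=> n ni.
have := sameD (n - i)%N _ _ sm 0; rewrite subnKC// => ->; last by lia.
by congr (coords (iter _ phi y) 0); lia.
Qed.

Context (R : realType) (mu : probability T R).

Lemma measurable_eventually_periodic q p j :
  measurable (eventually_periodic_at q p j).
Proof.
apply: (@measurable_forall _ _ nat) => i.
apply: locally_constant_measurable => x.
apply: filterS2 (coords_iter_near caphi x (i + p) j)
  (coords_iter_near caphi x i j).
by move=> y /= -> ->.
Qed.

Lemma measurable_orbit_ball m (x : T) : measurable (orbit_ball phi m x).
Proof.
apply: (@measurable_forall _ _ nat) => i.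
apply: (@measurable_forall _ _ int) => j.
apply: locally_constant_measurable => y.
by apply: filterS (coords_iter_near caphi y i j) => z /= ->.
Qed.

Lemma orbit_ball_eventually_periodic (x : T) :
  invariant_measure mu sigma -> (0 < mu (orbit_ball phi r x))%E ->
  exists q p, (0 < p)%N /\ orbit_ball phi r x `<=` eventually_periodic_at q p 0.
Proof.
move=> invs O0.
have invsr : invariant_measure mu (iter r.+1 sigma).
  split; first exact: (measurable_iter invs.1).
  by move=> B mB; exact: (invariant_iter invs).
(* Recurrence is applied to the [r.+1]-st power of the shift, so that the return distance
   [k.+1 * r.+1] is at least [r]. Both [y] and its translate follow the window orbit of [x], hence
   the two columns of [y] agree. *)
have [k [y [Oy Oky]]] := recurrence invsr (measurable_orbit_ball r x) O0.
have [||q [p [p0 qp]]] := @equal_columns_eventually_periodic y (k.+1 * r.+1)%N.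
- by rewrite mulSn; lia.
- move=> i l lr; move: (Oky i l lr) (Oy i l lr).
  by rewrite -iterM (iter_ca_shift caphi) coords_iter_shift => -> ->.
exists q, p; split=> // z Oz i qi.
have zx n : coords (iter n phi z) 0 = coords (iter n phi y) 0.
  by rewrite Oz ?normr0// -Oy ?normr0.
by rewrite !zx; exact: qp.
Qed.

(** If the orbit ball were null, every ratio in the definition would be 0 and could not tend to
    1. *)
Lemma equicontinuity_point_orbit_ball (x : T) m :
  equicontinuity_point mu phi x -> (0 < mu (orbit_ball phi m x))%E.
Proof.
move=> [_ /(_ m) xm]; rewrite lt0e measure_ge0 andbT; apply/negP => /eqP O0.
have W0 n : mu (window_ball n x `&` orbit_ball phi m x) = 0%E.
  apply/eqP; rewrite eq_le measure_ge0 andbT -O0; apply: le_measure.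
  - rewrite inE; apply: measurableI; first exact: measurable_window_ball.
    exact: measurable_orbit_ball.
  - by rewrite inE; exact: measurable_orbit_ball.
  - by move=> y [].
move: xm; under eq_fun do rewrite W0 /= mul0r.
move=> xm; have e : (1 : R) = 0 := cvg_unique (@Rhausdorff R) xm (cvg_cst 0).
by have := oner_neq0 R; rewrite e eqxx.
Qed.

(** The set for cell [i + 1] is the shift preimage of the set for cell [i]; negative cells are
    reached by climbing back up to 0. *)
Lemma eventually_periodic_shift q p j : invariant_measure mu sigma ->
  mu (eventually_periodic_at q p j) = mu (eventually_periodic_at q p 0).
Proof.
move=> invs.
pose E := eventually_periodic_at q p.
have step i : mu (E (i + 1)) = mu (E i).
  rewrite -[RHS](invs.2 _ (measurable_eventually_periodic q p i)); congr (mu _).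
  have EE n x : coords (iter n phi (sigma x)) i = coords (iter n phi x) (i + 1).
    by rewrite (iter_ca_shift caphi 1).
  by apply/seteqP; split=> x xE n qn; have := xE n qn; rewrite /= !EE.
have pos n : mu (E n%:Z) = mu (E 0).
  by elim: n => // n <-; rewrite -(step n%:Z) -PoszD addn1.
have neg n : mu (E (- n%:Z)) = mu (E 0).
  elim: n => [|n <-]; first by rewrite oppr0.
  by rewrite -(step (- n.+1%:Z)); congr (mu (E _)); lia.
by case: j => n; rewrite ?NegzE.
Qed.

End eventually_periodic.

(** * Cesaro means and their weak limit *)

Lemma pushforward_is_measure (R : realType) d1 d2 (S1 : measurableType d1)
    (S2 : measurableType d2) (mu : {measure set S1 -> \bar R}) (f : S1 -> S2) :
  measurable_fun [set: S1] f ->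
  exists m : {measure set S2 -> \bar R},
    m = pushforward mu f :> (set S2 -> \bar R).
Proof.
by move=> mf; unshelve eexists (pushforward mu f).
Qed.

Section cesaro.
Context (R : realType) (A : finType) (X : subshift A).
Local Notation T := (subshift_space X).
Context (mu nu : probability T R) (phi : T -> T).
Hypothesis caphi : cellular_automaton phi.
Hypothesis lim_nu : weak_limit (cesaro_mean mu phi) nu.
Local Open Scope ereal_scope.

Let mphi : measurable_fun [set: T] phi.
Proof. exact: continuous_measurable_map. Qed.

(** [cesaro_mean] is a bare set function; a measure with these values is needed to integrate
    indicators against it. *)
Lemma cesaro_mean_is_measure n :
  exists m : {measure set T -> \bar R},
    m = cesaro_mean mu phi n :> (set T -> \bar R).
Proof.
have /choice[m mE] i : exists m : {measure set T -> \bar R},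
    m = pushforward mu (iter i phi) :> (set T -> \bar R).
  exact: pushforward_is_measure (measurable_iter mphi i).
have n0 : (0 <= n%:R^-1 :> R)%R by rewrite invr_ge0.
exists (mscale (NngNum n0) (msum (fun i => m i.+1) n)); apply/funext => B.
rewrite /mscale /= /msum /cesaro_mean big_add1 /= big_mkord.
by congr (_ * _); apply: eq_bigr => i _; rewrite mE.
Qed.

Lemma weak_limit_locally_constant (P : set T) : locally_constant P ->
  cesaro_mean mu phi n P @[n --> \oo] --> nu P.
Proof.
move=> lP; have mP := locally_constant_measurable lP.
have := lim_nu (locally_constant_indic lP).
rewrite integral_indic// setIT.
have -> // : (fun n => \int[cesaro_mean mu phi n]_x (\1_P x)%:E) =
  (fun n => cesaro_mean mu phi n P).
apply/funext => n; have [m <-] := cesaro_mean_is_measure n.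
by rewrite integral_indic// setIT.
Qed.

(** Once [n >= 2 * q], at least half of the times [1, ..., n] exceed [q], which explains the factor
    1/2. *)
Lemma cesaro_mean_ge (P : set T) (c : R) q n : (0 <= c)%R -> measurable P ->
  (forall i, (q <= i)%N -> c%:E <= mu (iter i phi @^-1` P)) ->
  (2 * q <= n)%N -> (0 < n)%N -> (c / 2)%:E <= cesaro_mean mu phi n P.
Proof.
move=> c0 mP cP qn n0; rewrite /cesaro_mean.
apply: (@le_trans _ _ ((n%:R^-1)%:E * \sum_(q.+1 <= i < n.+1) c%:E));
  last first.
  apply: lee_wpmul2l; first by rewrite lee_fin invr_ge0.
  rewrite [leRHS](big_cat_nat (n := q.+1)) //=; last by lia.
  rewrite -[leLHS]add0e; apply: leeD.
    by apply: sume_ge0 => i _; rewrite /pushforward.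
  rewrite big_nat_cond [leRHS]big_nat_cond.
  apply: lee_sum => i /andP[/andP[qi _] _].
  by apply: cP; exact: ltnW.
rewrite sumEFin -EFinM lee_fin sumr_const_nat subSS.
rewrite -[X in (_ <= _ * X)%R]mulr_natr.
rewrite mulrCA ler_wpM2l// ler_pdivlMl ?ltr0n//.
rewrite natrB; last by lia.
have : (2 * q%:R <= n%:R :> R)%R by rewrite -natrM ler_nat.
by lra.
Qed.

Lemma weak_limit_eventually_periodic q p j :
  0 < mu (eventually_periodic_at phi q p j) ->
  0 < nu (eventually_periodic_at phi 0 p j).
Proof.
set E := eventually_periodic_at phi q p j => E0.
have mE : measurable E by exact: measurable_eventually_periodic.
pose c := fine (mu E).
have cE : c%:E = mu E by rewrite fineK// fin_num_measure.
have c0 : (0 < c)%R by rewrite -lte_fin cE.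
(* Periodicity up to a finite horizon [M] is a clopen condition, so weak convergence applies to it;
   the bound [c / 2] does not depend on [M] and survives the decreasing intersection. *)
pose P M := [set x : T | forall i, (i < M)%N ->
  coords (iter (i + p) phi x) j = coords (iter i phi x) j].
have lP M : locally_constant (P M).
  apply: (locally_constant_forall (P := fun i => [set x : T |
    coords (iter (i + p) phi x) j = coords (iter i phi x) j])) => i x.
  apply: filterS2 (coords_iter_near caphi x (i + p) j)
  (coords_iter_near caphi x i j).
  by move=> y /= -> ->.
have mP M : measurable (P M) by exact: locally_constant_measurable.
have nuP M : (c / 2)%:E <= nu (P M).
  apply: (cvge_ge _ (weak_limit_locally_constant (lP M))).
  (* The successor also makes [n] positive. *)
  exists (2 * q).+1 => // n /= qn.
  apply: (cesaro_mean_ge (q := q) (ltW c0) (mP M)).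
  (* After [i >= q] steps the preperiod is over, so [E] lies in the [i]-th preimage of every
     [P M]. *)
  - move=> i qi; rewrite cE; apply: le_measure; rewrite ?inE//.
      exact: (measurable_iter_preimage mphi).
    move=> x Ex k _; rewrite -!iterD addnAC.
    by apply: Ex; exact: leq_trans qi (leq_addl _ _).
  - exact: ltnW.
  - exact: leq_ltn_trans qn.
have -> : eventually_periodic_at phi 0 p j = \bigcap_M P M.
  apply/seteqP; split=> x xP; first by move=> M _ i _; exact: xP.
  by move=> i _; exact: (xP i.+1 I i).
apply: (@lt_le_trans _ _ (c / 2)%:E); first by rewrite lte_fin divr_gt0.
have cvgP : nu (P M) @[M --> \oo] --> nu (\bigcap_M P M).
  apply: nonincreasing_cvg_mu => //; first by rewrite ltey_eq fin_num_measure.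
    exact: bigcap_measurable.
  move=> m n mn; apply/subsetPset => x Px i im.
  by apply: Px; exact: leq_trans mn.
by apply: (cvge_ge _ cvgP); exact: nearW.
Qed.

End cesaro.

(** * Almost sure periodicity and atoms of the limit measure *)

Lemma ae_exists (R : realType) d (S : measurableType d) (mu : probability S R)
    (P : S -> Prop) : {ae mu, forall x, P x} -> exists x, P x.
Proof.
move=> [N [mN N0 NP]]; apply: contrapT => /forallNP nP.
have NT : N = setT by apply/seteqP; split=> // x _; apply: NP => /=; exact: nP.
have := probability_setT mu; rewrite -NT N0 => /eqP.
by rewrite eqe eq_sym oner_eq0.
Qed.

Lemma ae_forall (R : realType) d (S : measurableType d) (mu : probability S R)
    (I : countType) (P : I -> S -> Prop) :
  (forall i, {ae mu, forall x, P i x}) -> {ae mu, forall x, forall i, P i x}.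
Proof.
move=> aeP.
have : {ae mu, forall x n,
    if unpickle n is Some i then P i x else True}.
  by apply: ae_foralln => n; case: unpickle => [i|]; [exact: aeP|exact: aeW].
by apply: filterS => x xP i; have := xP (pickle i); rewrite pickleK.
Qed.

Section limit_measure.
Context (R : realType) (A : finType) (X : subshift A).
Local Notation T := (subshift_space X).
Variable nu : probability T R.
Local Open Scope ereal_scope.

(** There are only countably many window patterns, so the null cylinders together form a null
    set. *)
Lemma ae_support : {ae nu, forall x, forall n, 0 < nu (window_ball n x)}.
Proof.
apply: (@ae_forall _ _ _ _ nat) => n.
(* Encoding the window [[-n, n]] as a word indexes the cylinders by the countable type [seq A]. *)
pose pat (x : T) : seq A :=
  [seq (coords x (k%:Z - n%:Z)%R : A) | k <- iota 0 (n + n).+1].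
have patE x y : pat x = pat y -> window_ball n x = window_ball n y.
  have sub z t : pat z = pat t -> window_ball n z `<=` window_ball n t.
    move=> /eq_in_map zt w wz j jn; rewrite wz//.
    have := zt (absz (j + n%:Z)%R).
    have -> : ((absz (j + n%:Z)%R)%:Z - n%:Z = j)%R by lia.
    by apply; rewrite mem_iota; lia.
  by move=> xy; apply/seteqP; split; exact: sub.
have : {ae nu, forall x, forall w : seq A,
    pat x = w -> 0 < nu (window_ball n x)}.
  apply: ae_forall => w.
  have [[x0 xw]|nw] := pselect (exists x0, pat x0 = w); last first.
    by apply: aeW => x xw; case: nw; exists x.
  have [W0|W0] := eqVneq (nu (window_ball n x0)) 0; last first.
    apply: aeW => x; rewrite -xw => /patE ->.
    by rewrite lt0e W0 measure_ge0.
  exists (window_ball n x0); split=> //; first exact: measurable_window_ball.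
  move=> x /= /not_implyP[xw' _].
  rewrite (patE x0 x); last by rewrite xw.
  by move=> j.
by apply: filterS => x; exact.
Qed.

Variable phi : T -> T.
Hypothesis ergphi : ergodic nu phi.

Lemma ergodic_periodic_isomorphic p : (0 < p)%N ->
  {ae nu, forall x, iter p phi x = x} ->
  isomorphic_to_cyclic_permutation nu phi.
Proof.
move=> p0 aep.
have [x [xp xsupp]] : exists x, iter p phi x = x /\
    forall n, 0 < nu (window_ball n x).
  by apply: (@ae_exists _ _ _ nu); apply: filterS2 aep ae_support.
have nux : 0 < nu [set x].
  have cvgW :
      nu (window_ball n x) @[n --> \oo] --> nu (\bigcap_n window_ball n x).
    apply: nonincreasing_cvg_mu => //.
    - by rewrite ltey_eq fin_num_measure//; exact: measurable_window_ball.
    - by move=> n; exact: measurable_window_ball.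
    - by apply: bigcap_measurable => // n _; exact: measurable_window_ball.
    - by move=> m n mn; apply/subsetPset => y yn j jm; apply: yn; lia.
  have -> : [set x] = \bigcap_n window_ball n x.
    apply/seteqP; split=> [y -> n _ j //|y xy].
    by apply: subshift_space_ext => j; apply: (xy (absz j) I); lia.
  (* All windows around [x] have mass at least [1 / p], and they shrink to [x], which is therefore
     an atom. *)
  apply: (@lt_le_trans _ _ (p%:R^-1)%:E).
    by rewrite lte_fin invr_gt0 ltr0n.
  apply: (cvge_ge _ cvgW); apply: nearW => n.
  have := ergodic_periodic_bound ergphi p0 aep
    (measurable_window_ball n x) (xsupp n).
  by rewrite -lee_pdivrMl ?ltr0n// mule1.
have [[|q] [// _ xq xinj]] := minimal_period p0 xp.
exact: (ergodic_atom_isomorphic ergphi (@measurable_set1 _ _) nux xq xinj).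
Qed.

Hypothesis caphi : cellular_automaton phi.
Context (mu : probability T R).

Lemma ergodic_limit_periodic :
  invariant_measure mu (@subshift_map A X) -> mu_equicontinuous mu phi ->
  weak_limit (cesaro_mean mu phi) nu ->
  exists2 p, (0 < p)%N & {ae nu, forall x, iter p phi x = x}.
Proof.
move=> invs equi lim_nu.
have [r rP] := local_radius caphi.
have [x xequi] := ae_exists equi.
have O0 := equicontinuity_point_orbit_ball caphi r xequi.
have [q [p [p0 Oqp]]] := orbit_ball_eventually_periodic caphi rP invs O0.
exists p => //.
(* Shift invariance gives the same [q] and [p] at every cell, so that one period serves the whole
   configuration. *)
have E0 j : 0 < mu (eventually_periodic_at phi q p j).
  rewrite (eventually_periodic_shift caphi)//; apply: lt_le_trans O0 _.
  apply: le_measure; rewrite ?inE//; first exact: measurable_orbit_ball.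
  exact: measurable_eventually_periodic.
have aeE : {ae nu, forall x, forall j, eventually_periodic_at phi 0 p j x}.
  apply: (@ae_forall _ _ _ _ int) => j.
  have mE := measurable_eventually_periodic caphi 0 p j.
  (* Periodicity of cell [j] from time 0 on passes to the image under [phi], so ergodicity raises
     positive mass to full mass. *)
  apply: full_measure_ae => //; apply: (ergodic_forward_invariant ergphi) => //.
    by move=> y yE i _; have := yE i.+1 isT; rewrite addSn !iterSr.
  exact: (weak_limit_eventually_periodic caphi lim_nu (E0 j)).
apply: filterS aeE => y yE; apply: subshift_space_ext => j.
exact: (yE j 0%N).
Qed.

End limit_measure.

(** * Equivalence of ergodicity and cyclicity of the limit measure *)

Theorem corollary3p24 (R : realType) (A : finType) (X : subshift A)
    (mu mu_oo : probability (subshift_space X) R)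
    (phi : subshift_space X -> subshift_space X) :
  shift_of_finite_type X ->
  invariant_measure mu (@subshift_map A X) ->
  cellular_automaton phi ->
  mu_equicontinuous mu phi ->
  weak_limit (cesaro_mean mu phi) mu_oo ->
  (isomorphic_to_cyclic_permutation mu_oo phi <-> ergodic mu_oo phi).
Proof.
move=> _ invs caphi equi lim_oo; split.
  exact: isomorphic_to_cyclic_permutation_ergodic.
move=> erg.
have [p p0 aep] := ergodic_limit_periodic erg caphi invs equi lim_oo.
exact: (ergodic_periodic_isomorphic erg p0 aep).
Qed.
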